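(* Let $\Phi:\mathcal T^N\to\mathbb R$ and let $$\Phi^R(p):=\int_{[0,1]^N}\Phi\big(\Theta^{p,u}\big)\,du,\qquad p\in\mathcal R^N,$$ be its randomized extension, where $\Theta^{p,u}:=(\Theta^{1,p^1}(\cdot,u_1),\dots,\Theta^{N,p^N}(\cdot,u_N))$. Then $$\sup_{p\in\mathcal R^N}\Phi^R(p)=\sup_{\tau\in\mathcal T^N}\Phi(\tau).$$ Moreover, a profile $p^\star\in\mathcal R^N$ maximizes $\Phi^R$ over $\mathcal R^N$ if and only if $\Theta^{p^\star,u}\in\operatorname{argmax}_{\mathcal T^N}\Phi$ for Lebesgue-a.e. $u\in[0,1]^N$.
   Context: Fix $N\ge 2$. $(\Omega,\mathcal F,\mathbb F,\mathbb P)$ is a filtered probability space satisfying the usual conditions, where $\mathbb F=(\mathcal F_t)_{t\ge 0}$ is generated by a continuous exogenous state process $X=(X_t)_{t\ge0}$. $\mathcal T$ is the set of $\mathbb F$-stopping times $\tau:\Omega\to[0,\infty)$. $\mathcal R$ is the set of processes $p:[0,\infty)\times\Omega\to[0,1]$ that are $\mathbb F$-adapted, càdlàg, nondecreasing, with $p_{0-}=0$ and $p_\infty=\lim_{t\to\infty}p_t=1$. For $p\in\mathcal R^N$ and $u\in[0,1]^N$, $\Theta^{i,p^i}(\omega,u_i):=\inf\{t\ge0:p^i_t(\omega)>u_i\}$ (the convention at $u_i=1$ is immaterial); for a.e. $u$ each $\Theta^{i,p^i}(\cdot,u_i)$ is an element of $\mathcal T$. It is implicitly assumed that $u\mapsto\Phi(\Theta^{p,u})$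 is Lebesgue integrable on $[0,1]^N$ for every $p\in\mathcal R^N$, so that $\Phi^R$ is well defined. *)

(* Defs.v *)
From HB Require Import structures.
From mathcomp Require Import all_boot all_order all_algebra.
From mathcomp Require Import all_classical all_reals all_analysis.

Set Implicit Arguments.
Unset Strict Implicit.
Unset Printing Implicit Defensive.

Import Order.TTheory GRing.Theory Num.Theory.
Import numFieldNormedType.Exports.

Local Open Scope classical_set_scope.
Local Open Scope ring_scope.

Section lebesgue_Rn.
Context (R : realType).
Local Notation TR := (measurableTypeR R).

Section cons_measure.
Context (n : nat) (m : {sigma_finite_measure set (n.-tuple TR) -> \bar R}).

Definition consT (x : TR * n.-tuple TR) : n.+1.-tuple TR :=
  [the n.+1.-tuple TR of x.1 :: x.2].

Lemma measurable_consT : measurable_fun setT consT.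
Proof.
by apply: measurable_cons; [exact: measurable_fst|exact: measurable_snd].
Qed.

Definition cons_measure : set (n.+1.-tuple TR) -> \bar R :=
  pushforward (@lebesgue_measure R \x m)%E consT.

HB.instance Definition _ := Measure.copy cons_measure
  (measure_function_pushforward__canonical__measure_function_Measure
     (@lebesgue_measure R \x m)%E measurable_consT).

Let unconsT (x : n.+1.-tuple TR) : TR * n.-tuple TR :=
  (tnth x ord0, [tuple of behead x]).

Let consTK : cancel consT unconsT.
Proof. by case=> a b; congr pair; apply: val_inj. Qed.

Let cons_measure_sigma_finite : sigma_finite setT cons_measure.
Proof.
have /sigma_finiteP[F [TF ndF Foo]] := sigma_finiteT (@lebesgue_measure R).
have /sigma_finiteP[G [TG ndG Goo]] := sigma_finiteT m.
have munconsT : measurable_fun setT unconsT.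
  apply: measurable_fun_pair; first exact: measurable_tnth.
  exact: measurable_behead.
exists (fun k => unconsT @^-1` (F k `*` G k)).
  apply/seteqP; split => // x _.
  have [k _ Fk] : (\bigcup_k F k) (unconsT x).1 by rewrite -TF.
  have [l _ Gl] : (\bigcup_k G k) (unconsT x).2 by rewrite -TG.
  exists (maxn k l) => //; split.
  - by move: Fk; exact/subsetPset/ndF/leq_maxl.
  - by move: Gl; exact/subsetPset/ndG/leq_maxr.
move=> k; have [? ?] := Foo k; have [? ?] := Goo k; split.
  by rewrite -[X in measurable X]setTI; apply: munconsT => //; exact: measurableX.
rewrite /cons_measure /pushforward (_ : _ @^-1` _ = F k `*` G k).
  by rewrite product_measure1E// lte_mul_pinfty// ge0_fin_numE.
by apply/seteqP; split => x; rewrite /preimage/mkset consTK.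
Qed.

HB.instance Definition _ := Measure_isSigmaFinite.Build _ _ _ cons_measure
  cons_measure_sigma_finite.

End cons_measure.

Fixpoint borel_lebesgue (n : nat) :
    {sigma_finite_measure set (n.-tuple TR) -> \bar R} :=
  if n is k.+1 then cons_measure (borel_lebesgue k)
  else \d_([tuple] : 0.-tuple TR).

(* completed, so that measurability below means Lebesgue measurability *)
Definition lebesgue_measure_n (n : nat) :=
  @completed_measure_extension _ _ _ (borel_lebesgue n).

Arguments lebesgue_measure_n : clear implicits.

HB.instance Definition _ n := Measure.on (lebesgue_measure_n n).

Lemma lebesgue_measure_n_complete n :
  measure_is_complete (lebesgue_measure_n n).
Proof. exact: measure_is_complete_caratheodory. Qed.

Definition box n (A : 'I_n -> set TR) : set (n.-tuple TR) :=
  [set u | forall i, A i (tnth u i)].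

Lemma measurable_box n (A : 'I_n -> set TR) :
  (forall i, measurable (A i)) -> measurable (box A).
Proof.
move=> mA.
rewrite (_ : box A = \big[setI/setT]_(i < n) ((@tnth n TR)^~ i @^-1` A i)).
  apply: bigsetI_measurable => i _; rewrite -[X in measurable X]setTI.
  exact: measurable_tnth.
apply/seteqP; split => [u uA|u].
  by elim/big_ind : _ => // i _; exact: uA.
move=> + i; rewrite (bigD1 i)//= => -[].
by [].
Qed.

Lemma borel_lebesgue_box n (A : 'I_n -> set TR) :
  (forall i, measurable (A i)) ->
  borel_lebesgue n (box A) = (\prod_(i < n) lebesgue_measure (A i))%E.
Proof.
elim: n A => [|n IH] A mA.
  by rewrite big_ord0 /= diracE mem_set// => -[].
rewrite big_ord_recl -(IH (fun i => A (lift ord0 i)))//=.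
rewrite /cons_measure /pushforward -product_measure1E//; last first.
  exact: measurable_box.
congr product_measure1; apply/seteqP; split => -[x v] /=.
  move=> h; split; first exact: (h ord0).
  by move=> i; have := h (lift ord0 i); rewrite tnthS.
move=> [h0 h1] i; case: (unliftP ord0 i) => [j ->|->]; last exact: h0.
by rewrite tnthS; exact: h1.
Qed.

Lemma lebesgue_measure_n_box n (A : 'I_n -> set TR) :
  (forall i, measurable (A i)) ->
  lebesgue_measure_n n (box A) = (\prod_(i < n) lebesgue_measure (A i))%E.
Proof.
move=> mA; rewrite -borel_lebesgue_box//.
by apply: measurable_mu_extE; exact: measurable_box.
Qed.

Definition unit_cube n : set (n.-tuple TR) :=
  [set u | forall i, 0 <= tnth u i <= 1].

End lebesgue_Rn.
Arguments lebesgue_measure_n : clear implicits.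
Arguments unit_cube : clear implicits.

Section randomized_stopping.
Context (R : realType) (d : measure_display) (Omega : measurableType d).

(* Time is indexed by R; only indices t >= 0 are constrained. *)
Record usual_filtration (P : probability Omega R) := UsualFiltration {
  filtration_at :> R -> set (set Omega) ;
  filtration_sigma : forall t : R, 0 <= t -> sigma_algebra setT (filtration_at t) ;
  filtration_sub : forall t : R, 0 <= t -> filtration_at t `<=` measurable ;
  filtration_mono : forall s t : R, 0 <= s -> s <= t ->
    filtration_at s `<=` filtration_at t ;
  filtration_complete : measure_is_complete P ;
  filtration_null : P.-negligible `<=` filtration_at 0 ;
  filtration_rcont : forall t : R, 0 <= t ->
    filtration_at t = \bigcap_(s in [set s : R | t < s]) filtration_at s }.

Definition natural_filtration (E : topologicalType) (X : R -> Omega -> E)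
    (t : R) : set (set Omega) :=
  <<s [set A | exists (s : R) (B : set E),
         [/\ 0 <= s <= t, <<s open >> B & A = X s @^-1` B]] >>.

(* F is the usual augmentation of the raw filtration of X: the smallest
   filtration satisfying the usual conditions to which X is adapted. *)
Definition generated_by (P : probability Omega R) (F : usual_filtration P)
    (E : topologicalType) (X : R -> Omega -> E) : Prop :=
  forall t : R, 0 <= t ->
    F t = \bigcap_(s in [set s : R | t < s])
            <<s natural_filtration X s `|` P.-negligible >>.

Definition continuous_process (E : topologicalType) (X : R -> Omega -> E) :=
  forall w, {within [set t : R | 0 <= t], continuous (X ^~ w)}.

Context (P : probability Omega R) (F : usual_filtration P).

Record stopping_time := StoppingTime {
  stopping_time_val :> Omega -> R ;
  stopping_time_ge0 : forall w, 0 <= stopping_time_val w ;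
  stopping_timeP : forall t : R, 0 <= t ->
    F t [set w | stopping_time_val w <= t] }.

(* A process on [0, +oo[ with p_{0-} = 0 is identified with its extension by 0
   to negative times. *)
Record randomized_time := RandomizedTime {
  randomized_time_val :> R -> Omega -> R ;
  randomized_time01 : forall (t : R) w, 0 <= randomized_time_val t w <= 1 ;
  randomized_time_adapted : forall t : R, 0 <= t -> forall B : set R,
    measurable B -> F t (randomized_time_val t @^-1` B) ;
  randomized_time_lt0 : forall (t : R) w, t < 0 -> randomized_time_val t w = 0 ;
  randomized_time_rcont : forall (t : R) w,
    randomized_time_val s w @[s --> t^'+] --> randomized_time_val t w ;
  randomized_time_llim : forall (t : R) w,
    cvg (randomized_time_val s w @[s --> t^'-]) ;
  randomized_time_mono : forall w (s t : R), s <= t ->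
    randomized_time_val s w <= randomized_time_val t w ;
  randomized_time_lim : forall w,
    randomized_time_val t w @[t --> +oo] --> (1 : R) }.

(* For u >= 1 the set is empty, and inf set0 = 0. *)
Definition theta_val (p : randomized_time) (u : R) (w : Omega) : R :=
  inf [set t : R | 0 <= t /\ u < p t w].

Lemma theta_ge0 p u w : 0 <= theta_val p u w.
Proof.
rewrite /theta_val; set S := [set t | _].
have [->|/set0P S0] := eqVneq S set0; first by rewrite inf0.
by apply: lb_le_inf => // y [].
Qed.

Lemma theta_stopping p u (t : R) : 0 <= t -> F t [set w | theta_val p u w <= t].
Proof.
move=> t0; rewrite filtration_rcont// => s /= ts.
have s0 : 0 <= s by exact/(le_trans t0)/ltW.
have [F0 FC FU] := filtration_sigma F s0.
have [u1|u1] := leP 1 u.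
  rewrite (_ : [set w | _] = setT); first by rewrite -(setD0 setT); exact: FC.
  apply/seteqP; split => // w _ /=; rewrite /theta_val.
  rewrite (_ : [set t | _] = set0) ?inf0//.
  apply/seteqP; split => // r [_] /=.
  by rewrite ltNge (le_trans _ u1)//; case/andP: (randomized_time01 p r w).
pose r n := t + (s - t) / n.+1%:R.
have st0 : 0 < s - t by rewrite subr_gt0.
have tr n : t < r n by rewrite ltrDl divr_gt0.
have rs n : r n <= s.
  by rewrite -lerBrDl ler_pdivrMr// ler_peMr ?ler1n// ltW.
rewrite (_ : [set w | _] = setT `\` \bigcup_n (setT `\` (p (r n) @^-1` `]u, +oo[))).
  apply: (FC); apply: FU => n; apply: FC.
  apply: (@filtration_mono _ F (r n) s) => //; first by rewrite (le_trans t0)// ltW.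
  by apply: randomized_time_adapted => //; rewrite (le_trans t0)// ltW.
have hasS w : has_inf [set t : R | 0 <= t /\ u < p t w].
  split; last by exists 0 => y [].
  have [M [_ HM]] := cvgr_gt _ (@randomized_time_lim p w) u u1.
  exists (Num.max 0 (M + 1)); split; first by rewrite le_max lexx.
  by apply: HM; rewrite lt_max ltrDl ltr01 orbT.
apply/seteqP; split => w /=.
  move=> th; split => // -[n _] [_] /=; rewrite in_itv/= andbT; apply.
  have /(inf_lt (hasS w).1)[y [y0 uy] yr] := le_lt_trans th (tr n).
  by apply: (lt_le_trans uy); exact/randomized_time_mono/ltW.
move=> [_ h]; apply/ler_addgt0Pr => e e0.
have [n ne] : exists n, r n <= t + e.
  exists (Num.truncn ((s - t) / e)); rewrite lerD2l ler_pdivrMr//.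
  rewrite mulrC -ler_pdivrMr//; apply: ltW.
  by rewrite truncnS_gt.
apply: (le_trans _ ne); apply: ge_inf; first exact: (hasS w).2.
split; first by rewrite (le_trans t0)// ltW.
apply: contrapT => nu; apply: h; exists n => //; split => //=.
by rewrite in_itv/= andbT.
Qed.

Definition theta (p : randomized_time) (u : R) : stopping_time :=
  StoppingTime (theta_ge0 p u) (@theta_stopping p u).

Definition Theta (N : nat) (p : 'I_N -> randomized_time)
    (u : N.-tuple (measurableTypeR R)) : 'I_N -> stopping_time :=
  fun i => theta (p i) (tnth u i).

Definition randomized_extension (N : nat) (Phi : ('I_N -> stopping_time) -> R)
    (p : 'I_N -> randomized_time) : R :=
  \int[lebesgue_measure_n R N]_(u in unit_cube R N) Phi (Theta p u).

End randomized_stopping.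

Definition maximizes (T : Type) (R : realType) (f : T -> R) (x : T) : Prop :=
  forall y, f y <= f x.

(* Main.v *)
(** The half-open unit cube has full measure in the closed one, and on it the
    indicator process [t |-> 1_{tau <= t}] of a stopping time [tau] satisfies
    [Theta = tau]; hence every value of [Phi] is a value of its randomized
    extension.  Conversely the randomized extension is an average of values of
    [Phi] against a probability measure: it cannot exceed their supremum, and
    attains a finite supremum only if almost every averaged value does. *)
Require Import Defs.
From HB Require Import structures.
From mathcomp Require Import all_boot all_order all_algebra.
From mathcomp Require Import all_classical all_reals all_analysis.
From mathcomp Require Import measurable_realfun.
Import Order.TTheory GRing.Theory Num.Theory.
Import numFieldNormedType.Exports.
Local Open Scope classical_set_scope.
Local Open Scope ring_scope.

(** * Averages over a set of mass one *)

Section average.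
Context {d : measure_display} {T : measurableType d} {R : realType}.
Variables (mu : {measure set T -> \bar R}) (D : set T).
Hypotheses (mD : measurable D) (muD : mu D = 1%E).

Lemma average_cst (c : R) : \int[mu]_(x in D) c = c.
Proof. by rewrite Rintegral_cst// muD /= mulr1. Qed.

Lemma integrable_cst1 (c : R) : mu.-integrable D (EFin \o cst c).
Proof.
apply/integrableP; split; first exact/measurable_EFinP.
by rewrite (integral_cst mu mD `|c%:E|%E) muD mule1 ltry.
Qed.

Variable f : T -> R.
Hypothesis intf : mu.-integrable D (EFin \o f).

Lemma average_le (c : R) :
  (forall x, D x -> f x <= c) -> \int[mu]_(x in D) f x <= c.
Proof.
move=> fc; rewrite -[leRHS]average_cst.
by apply: le_Rintegral => //; exact: integrable_cst1.
Qed.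

Lemma average_ae_cst (c : R) :
  {ae mu, forall x, D x -> f x = c} -> \int[mu]_(x in D) f x = c.
Proof.
move=> fc; rewrite -[RHS]average_cst /Rintegral; congr fine.
apply: ae_eq_integral => //; first exact: measurable_int intf.
by apply: filterS fc => x fx Dx /=; rewrite fx.
Qed.

(** The function [c - f] is nonnegative on [D] with zero integral, so it vanishes almost everywhere
    there. *)
Lemma average_max (c : R) :
  (forall x, D x -> f x <= c) -> \int[mu]_(x in D) f x = c ->
  {ae mu, forall x, D x -> f x = c}.
Proof.
move=> fc intfc.
have mcf : measurable_fun D (EFin \o (fun x => c - f x)).
  apply/measurable_EFinP; apply: measurable_funB => //.
  exact/measurable_EFinP/(measurable_int mu).
have : (\int[mu]_(x in D) `|(EFin \o (fun x => (c - f x)%R)) x| = 0)%E.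
  rewrite (eq_integral (fun x => ((cst c x)%:E - (f x)%:E)%E)); last first.
    move=> x /set_mem Dx /=.
    by rewrite ger0_norm ?subr_ge0 ?fc// EFinB.
  rewrite integralB_EFin//; last exact: integrable_cst1.
  (* Both integrals are finite, so the subtraction can be carried out on real numbers, where the
     hypothesis on the average applies. *)
  rewrite -[X in (_ - X)%E]fineK; last exact: integrable_fin_num.
  rewrite -[X in (X - _)%E]fineK; last exact/integrable_fin_num/integrable_cst1.
  by rewrite -EFinB -!/(Rintegral _ _ _) average_cst intfc subrr.
move/(ae_eq_integral_abs mu mD mcf); apply: filterS => x /= h Dx.
by case: (h Dx) => /eqP; rewrite subr_eq0 => /eqP.
Qed.

(** Otherwise all of [D] would lie in the exceptional null set, against [mu D = 1]. This extracts
    actual sample points from almost-everywhere statements. *)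
Lemma ae_inhabited (Q : T -> Prop) :
  {ae mu, forall x, D x -> Q x} -> exists2 x, D x & Q x.
Proof.
move=> aeQ; apply: contrapT => nQ.
have Dneg : mu.-negligible D.
  apply: negligibleS aeQ => x Dx /= h.
  by apply: nQ; exists x => //; exact: h.
have : mu D = 0%E by exact/negligibleP.
by rewrite muD => /eqP; rewrite onee_eq0.
Qed.

End average.

#[global] Instance lebesgue_ae_filter (R : realType) (N : nat) :
  Filter (nbhs (almost_everywhere (lebesgue_measure_n R N))).
Proof. exact: ae_filter_ringOfSetsType. Qed.

(** * The unit cube under completed Lebesgue measure *)

Section unit_cube.
Context {R : realType} {N : nat}.

Lemma unit_cubeE : unit_cube R N = box (fun=> `[0, 1]%classic).
Proof. by apply/seteqP; split => u uN i; have := uN i; rewrite /= in_itv. Qed.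

(** Borel sets are Caratheodory measurable; the type ascription selects the completed sigma-algebra
    on which [lebesgue_measure_n] is a measure. *)
Lemma lebesgue_measurable_box (A : 'I_N -> set (measurableTypeR R)) :
  (forall i, measurable (A i)) ->
  measurable (box A : set (caratheodory_type (mu_ext (borel_lebesgue R N)))).
Proof.
by move=> mA; apply: caratheodory_measurable_mu_ext; exact: measurable_box.
Qed.

Lemma measurable_unit_cube : measurable
  (unit_cube R N : set (caratheodory_type (mu_ext (borel_lebesgue R N)))).
Proof. by rewrite unit_cubeE; exact: lebesgue_measurable_box. Qed.

Lemma lebesgue_measure_unit_cube : lebesgue_measure_n R N (unit_cube R N) = 1%E.
Proof.
rewrite unit_cubeE lebesgue_measure_n_box// big1// => i _.
by rewrite lebesgue_measure_itv/= lte_fin ltr01 oppr0 adde0.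
Qed.

(** The closed and half-open cubes both have measure one. The faces with a coordinate equal to 1
    must be discarded because there [theta_val] is the infimum of the empty set, which is 0 by
    default. *)
Lemma ae_unit_cube_lt1 : {ae lebesgue_measure_n R N, forall u,
  unit_cube R N u -> forall i, 0 <= tnth u i < 1}.
Proof.
pose U := caratheodory_type (mu_ext (borel_lebesgue R N)).
pose C : set U := unit_cube R N.
pose H : set U := box (fun=> `[0, 1[%classic).
have mH : measurable H by exact: lebesgue_measurable_box.
have mC : measurable C by exact: measurable_unit_cube.
have C1 : lebesgue_measure_n R N C = 1%E by exact: lebesgue_measure_unit_cube.
have H1 : lebesgue_measure_n R N H = 1%E.
  rewrite /H lebesgue_measure_n_box// big1// => i _.
  by rewrite lebesgue_measure_itv/= lte_fin ltr01 oppr0 adde0.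
have HC : H `<=` C.
  by move=> u Hu i; have := Hu i; rewrite /= in_itv/= => /andP[-> /ltW].
exists (C `\` H); split; first exact: measurableD.
- have -> : lebesgue_measure_n R N (C `\` H) =
      (lebesgue_measure_n R N C - lebesgue_measure_n R N (C `&` H))%E.
    by apply: measureD => //; rewrite [ltLHS]C1 ltry.
  by rewrite (setIidr HC) C1 H1 subee.
- by move=> u /not_implyP[Cu nu]; split.
Qed.

End unit_cube.

(** * Stopping times as randomized stopping times *)

Section pure_time.
Context {R : realType} {d : measure_display} {Omega : measurableType d}.
Context {P : probability Omega R} {F : usual_filtration P}.

(** By proof irrelevance. Equality of the records themselves is needed because [Phi] is an arbitrary
    function of them. *)
Lemma stopping_time_eq (sigma tau : stopping_time F) :
  sigma =1 tau -> sigma = tau.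
Proof.
case: sigma tau => [s s0 sP] [t t0 tP] /= /funext st.
by subst t; congr StoppingTime; exact: Prop_irrelevance.
Qed.

Variable tau : stopping_time F.

Definition pure_val (t : R) (w : Omega) : R := (tau w <= t)%R%:R.

Lemma pure_val01 t w : 0 <= pure_val t w <= 1.
Proof. by rewrite /pure_val ler0n lern1 leq_b1. Qed.

Lemma pure_val_adapted (t : R) : 0 <= t -> forall B : set R,
  measurable B -> F t (pure_val t @^-1` B).
Proof.
move=> t0 B _; have [F0 FC FU] := filtration_sigma F t0.
have FT : F t setT by rewrite -(setD0 setT); exact: FC.
have Ft := stopping_timeP tau t0.
(* Only the values 0 and 1 occur, so the preimage of [B] is the whole space, the event [tau w <= t],
   its complement, or empty. *)
have [B0|B0] := pselect (B 0); have [B1|B1] := pselect (B 1).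
- rewrite (_ : _ @^-1` B = setT)//.
  by apply/seteqP; split => // w _; rewrite /pure_val /=; case: (tau w <= t).
- rewrite (_ : _ @^-1` B = setT `\` [set w | tau w <= t]); first exact: FC.
  apply/seteqP; split => w; rewrite /pure_val /=.
    by case: (tau w <= t).
  by case: (tau w <= t) => // -[_ /(_ isT)].
- rewrite (_ : _ @^-1` B = [set w | tau w <= t])//.
  by apply/seteqP; split => w; rewrite /pure_val /=; case: (tau w <= t).
- rewrite (_ : _ @^-1` B = set0)//.
  by apply/seteqP; split => w; rewrite /pure_val /=; case: (tau w <= t).
Qed.

Lemma pure_val_lt0 (t : R) w : t < 0 -> pure_val t w = 0.
Proof.
move=> t0; rewrite /pure_val leNgt (lt_le_trans t0)//.
exact: stopping_time_ge0.
Qed.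

Lemma pure_val_rcont (t : R) w :
  pure_val s w @[s --> t^'+] --> pure_val t w.
Proof.
apply: cvg_near_cst; rewrite /pure_val; have [tt|tt] := leP (tau w) t.
  near=> s; rewrite (le_trans tt)//; exact: ltW.
near=> s; rewrite leNgt (_ : s < tau w)//; near: s; exact: nbhs_right_lt.
Unshelve. all: by end_near. Qed.

Lemma pure_val_llim (t : R) w : cvg (pure_val s w @[s --> t^'-]).
Proof.
(* The comparison is strict: at [t = tau w] the left limit is 0 although the value is 1. *)
apply/cvg_ex; have [tt|tt] := ltP (tau w) t.
  exists 1; apply: cvg_near_cst; near=> s.
  rewrite /pure_val (_ : tau w <= s)//; near: s; exact: nbhs_left_ge.
exists 0; apply: cvg_near_cst; near=> s.
rewrite /pure_val leNgt (lt_le_trans _ tt)//; near: s; exact: nbhs_left_lt.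
Unshelve. all: by end_near. Qed.

Lemma pure_val_mono w (s t : R) : s <= t -> pure_val s w <= pure_val t w.
Proof.
rewrite /pure_val ler_nat => st; have [ts|//] := boolP (tau w <= s).
by rewrite (le_trans ts st).
Qed.

Lemma pure_val_lim w : pure_val t w @[t --> +oo] --> (1 : R).
Proof.
apply: cvg_near_cst; near=> t.
rewrite /pure_val (_ : tau w <= t)//; near: t; exact: nbhs_pinfty_ge.
Unshelve. all: by end_near. Qed.

Definition pure_time : randomized_time F :=
  @RandomizedTime _ _ _ _ F pure_val pure_val01 pure_val_adapted pure_val_lt0
    pure_val_rcont pure_val_llim pure_val_mono pure_val_lim.

(** An indicator exceeds a level in [[0, 1[] exactly when it equals 1, that is, from time [tau w]
    on. *)
Lemma theta_pure_time (u : R) : 0 <= u < 1 -> theta pure_time u = tau.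
Proof.
case/andP => u0 u1; apply: stopping_time_eq => w /=; rewrite /theta_val /=.
rewrite (_ : [set t | _] = `[tau w, +oo[%classic) ?inf_itv//.
apply/seteqP; split => t /=; rewrite in_itv/= andbT /pure_val.
  by case: (tau w <= t) => -[_]//; rewrite ltNge u0.
by move=> tt; rewrite tt u1 (le_trans (stopping_time_ge0 tau w)).
Qed.

End pure_time.

(** * Suprema and maximizers of the randomized extension *)

Section randomized_extension.
Context {R : realType} {d : measure_display} {Omega : measurableType d}.
Context {P : probability Omega R} {F : usual_filtration P} {N : nat}.
Variable Phi : ('I_N -> stopping_time F) -> R.
Hypothesis Phi_int : forall p : 'I_N -> randomized_time F,
  (lebesgue_measure_n R N).-integrable (unit_cube R N)
    (fun u => (Phi (Theta p u))%:E).

Let mcube := @measurable_unit_cube R N.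
Let cube1 := @lebesgue_measure_unit_cube R N.

Lemma randomized_extension_pure (tau : 'I_N -> stopping_time F) :
  randomized_extension Phi (fun i => pure_time (tau i)) = Phi tau.
Proof.
apply: (average_ae_cst (lebesgue_measure_n R N) _ mcube cube1).
  exact: Phi_int.
apply: filterS ae_unit_cube_lt1 => u hu Cu; congr Phi.
by apply/funext => i; rewrite /Theta theta_pure_time//; exact: hu.
Qed.

Lemma randomized_extension_le (p : 'I_N -> randomized_time F) (c : R) :
  (forall tau, Phi tau <= c) -> randomized_extension Phi p <= c.
Proof.
move=> Phic; apply: (average_le (lebesgue_measure_n R N) _ mcube cube1) => //.
exact: Phi_int.
Qed.

Lemma ereal_sup_randomized_extension :
  ereal_sup [set (randomized_extension Phi p)%:E
            | p in [set: 'I_N -> randomized_time F]]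
  = ereal_sup [set (Phi tau)%:E | tau in [set: 'I_N -> stopping_time F]].
Proof.
apply/eqP; rewrite eq_le; apply/andP; split; apply: ge_ereal_sup.
  move=> _ [p _ <-]; set S := ereal_sup _.
  have PhiS tau : ((Phi tau)%:E <= S)%E by apply: ereal_sup_ubound; exists tau.
  (* An infinite supremum bounds everything. The value [-oo] is excluded by the real number
     [Phi (Theta p u)] at any point [u] of the cube. *)
  case ES : S PhiS => [s| |] PhiS; last 2 first.
  - exact: leey.
  - have [u _ _] := ae_inhabited (lebesgue_measure_n R N) _ mcube cube1
      (fun=> True) (aeW _ (fun _ _ => I)).
    by have := PhiS (Theta p u).
  - by rewrite lee_fin; apply: randomized_extension_le => tau; exact: PhiS.
move=> _ [tau _ <-]; apply: ereal_sup_ubound.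
by exists (fun i => pure_time (tau i)) => //; rewrite randomized_extension_pure.
Qed.

Lemma maximizes_randomized_extension (p : 'I_N -> randomized_time F) :
  maximizes (randomized_extension Phi) p <->
  {ae lebesgue_measure_n R N, forall u,
    unit_cube R N u -> maximizes Phi (Theta p u)}.
Proof.
split => [pmax|aemax].
  have Phip tau : Phi tau <= randomized_extension Phi p.
    by rewrite -randomized_extension_pure; exact: pmax.
  (* The bound [c] is the average itself, so the equality that [average_max] asks for holds by
     reflexivity. *)
  have := average_max (lebesgue_measure_n R N) _ mcube cube1 _ (Phi_int p) _
    (fun u _ => Phip (Theta p u)) erefl.
  by apply: filterS => u Phiu /Phiu Phiup tau; rewrite Phiup.
(* One good sample [u] fixes the maximal value; any other good sample [v] also maximizes [Phi] and
   so gives the same value, which is therefore the average. *)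
have [u Cu umax] := ae_inhabited (lebesgue_measure_n R N) _ mcube cube1 _ aemax.
have Ep : randomized_extension Phi p = Phi (Theta p u).
  apply: (average_ae_cst (lebesgue_measure_n R N) _ mcube cube1).
    exact: Phi_int.
  apply: filterS aemax => v vmax /vmax {}vmax.
  by apply/eqP; rewrite eq_le umax vmax.
by move=> q; rewrite Ep; exact: randomized_extension_le.
Qed.

End randomized_extension.

Theorem proposition2p10 (N : nat) (hN : (2 <= N)%N)
    (R : realType) (d : measure_display) (Omega : measurableType d)
    (P : probability Omega R) (F : usual_filtration P)
    (E : topologicalType) (X : R -> Omega -> E)
    (Xcont : continuous_process X) (FX : generated_by F X)
    (Phi : ('I_N -> stopping_time F) -> R)
    (Phi_int : forall p : 'I_N -> randomized_time F,
      (lebesgue_measure_n R N).-integrable (unit_cube R N)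
        (fun u => (Phi (Theta p u))%:E)) :
  ereal_sup [set (randomized_extension Phi p)%:E
            | p in [set: 'I_N -> randomized_time F]]
  = ereal_sup [set (Phi tau)%:E | tau in [set: 'I_N -> stopping_time F]]
  /\
  forall pstar : 'I_N -> randomized_time F,
    maximizes (randomized_extension Phi) pstar <->
    {ae lebesgue_measure_n R N, forall u,
      unit_cube R N u -> maximizes Phi (Theta pstar u)}.
Proof.
split; first exact: ereal_sup_randomized_extension.
by move=> pstar; exact: maximizes_randomized_extension.
Qed.
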